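(* Let $p$ be an odd prime and let $L/K$ be a Galois extension of fields with Galois group $G=(A,+)$, an abelian $p$-group of order $p^n$. Let $(A,+,\cdot)$ be a commutative nilpotent ring structure on $(A,+)$ and suppose $A^3=0$. Then $T=\lambda_\circ(A)\subset \mathrm{Perm}(A)$ yields a Hopf Galois structure on $L/K$ by a $K$-Hopf algebra $H$, where: (i) $H$ is the fixed ring of the group ring $LT$ under the action of $G$: $$H=(LT)^G=\Big\{\sum_{x\in G} b_x\lambda_\circ(x)\;:\; b_x\in L,\ b_{x-x\cdot z}=b_x^{\,z}\text{ for all } x,z\in G\Big\};$$ (ii) $H$ acts on $L$ by $$\Big(\sum_{x\in G} b_x\lambda_\circ(x)\Big)(a)=\sum_{x\in G} b_x\,a^{-x+x^2}$$ for $\sum_{x\in G} b_x\lambda_\circ(x)\in H$ and $a\in L$.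
   Context: A nilpotent ring structure $(A,+,\cdot)$ on $(A,+)$ is an associative (non-unital) ring with $A^m=0$ for some $m>1$; $A^3=0$ means $a\cdot b\cdot c=0$ for all $a,b,c\in A$. The adjoint operation is $a\circ b=a+b+a\cdot b$, which makes $A$ a group $(A,\circ)$ with identity $0$. $\mathrm{Perm}(A)$ is the group of permutations of the set $A$, with $\lambda_+(a)(x)=a+x$ and $\lambda_\circ(a)(x)=a\circ x$. The Galois group $G$ is written additively and identified with $(A,+)$; for $a\in L$ and $z\in G$, $a^z$ denotes the image of $a$ under the Galois action of $z$. The exponent $-x+x^2$ is the element $-x+x\cdot x$ of $A=G$. Hopf Galois structures (Greither--Pareigis): a Hopf Galois structure on $L/K$ is a $K$-Hopf algebra $H$ with an action on $L$ making $L$ an $H$-module algebra such that the induced map $L\otimes_K H\to \mathrm{End}_K(L)$ is bijective. A regular subgroup $T\subset \mathrm{Perm}(G)$ normalized by the image $\lambda_+(G)$ of the left regular representation of the Galois group yields a Hopf Galois structure as follows. $G$ acts on the group ring $LT$ by the Galois action on $L$ and by conjugation by $\lambda_+(G)$ on $T$, and $H=(LT)^G$. The ring $GL=\bigoplus_{z\in G}Le_z$ of functions from $G$ to $L$, where $\{e_z: z\in G\}$ is the dual basis to the basis $G$ of $L[G]$, is acted on by $LT$ through $t(e_z)=e_{t(z)}$ for $t\in T$, and $H$ acts on $L$ through the embedding $L\to GL$, $a\mapsto\sum_{y\in G}a^y e_y$. *)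

(* Defs.v *)
From HB Require Import structures.
From mathcomp Require Import all_boot all_order all_algebra.
From mathcomp Require Import all_fingroup all_solvable all_field.

Set Implicit Arguments.
Unset Strict Implicit.
Unset Printing Implicit Defensive.

Import GroupScope GRing.Theory.
Local Open Scope ring_scope.

Reserved Notation "u '*t' v" (at level 40, left associativity).

(* The tensor product of finite-dimensional K-vector spaces, written in       *)
(* coordinates: the matrix X stands for \sum_(i, j) X i j *: (e_i *t f_j) on  *)
(* the chosen bases e, f. Its universal property is tens_lift_pure together   *)
(* with tens_ext below. Finite dimension is no restriction for Hopf Galois    *)
(* structures on L/K with [L : K] finite: L (x) H ~ End_K(L) forces           *)
(* dim H = [L : K].                                                           *)
Section Tensor.
Variable K : fieldType.
Implicit Types U V : vectType K.

Definition tens U V := 'M[K]_(\dim {:U}, \dim {:V}).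

Definition tens_pure U V (u : U) (v : V) : tens U V :=
  \matrix_(i, j) (coord (vbasis {:U}) i u * coord (vbasis {:V}) j v).

(* The linear map out of U (x) V induced by a bilinear map b. *)
Definition tens_lift U V (W : lmodType K) (b : U -> V -> W) (X : tens U V) : W :=
  \sum_i \sum_j X i j *: b (vbasis {:U})`_i (vbasis {:V})`_j.

Lemma tens_lift_is_linear U V (W : lmodType K) (b : U -> V -> W) :
  linear (tens_lift b).
Proof.
move=> k X Y; rewrite /tens_lift scaler_sumr -big_split /=.
apply: eq_bigr => i _; rewrite scaler_sumr -big_split /=.
by apply: eq_bigr => j _; rewrite !mxE scalerDl scalerA.
Qed.

HB.instance Definition _ U V (W : lmodType K) (b : U -> V -> W) :=
  GRing.isLinear.Build K (tens U V) W _ (tens_lift b) (tens_lift_is_linear b).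

Lemma tens_lift_pure U V (W : lmodType K) (b : U -> V -> W) :
    (forall v, linear (b^~ v)) -> (forall u, linear (b u)) ->
  forall u v, tens_lift b (tens_pure u v) = b u v.
Proof.
move=> bl br u v.
pose bL y : {linear U -> W} := HB.pack (b^~ y)
  (GRing.isLinear.Build K U W _ (b^~ y) (bl y)).
pose bR x : {linear V -> W} := HB.pack (b x)
  (GRing.isLinear.Build K V W _ (b x) (br x)).
rewrite [in RHS](coord_vbasis (memvf u)) -[RHS]/(bL v _) linear_sum.
apply: eq_bigr => i _; rewrite linearZ /=.
rewrite [in RHS](coord_vbasis (memvf v)) -[b _ _ in RHS]/(bR _ _) linear_sum.
by rewrite scaler_sumr; apply: eq_bigr => j _; rewrite mxE linearZ scalerA.
Qed.

Lemma tens_ext U V (W : lmodType K) (f g : {linear tens U V -> W}) :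
  (forall u v, f (tens_pure u v) = g (tens_pure u v)) -> f =1 g.
Proof.
move=> fg X; rewrite (matrix_sum_delta X) !linear_sum; apply: eq_bigr => i _.
rewrite !linear_sum; apply: eq_bigr => j _; rewrite !linearZ; congr (_ *: _).
suff <- : tens_pure (vbasis {:U})`_i (vbasis {:V})`_j = delta_mx i j.
  by rewrite fg.
apply/matrixP=> k l; rewrite !mxE !coord_free ?(basis_free (vbasisP _)) //.
by rewrite -natrM mulnb (eq_sym i) (eq_sym j).
Qed.

Definition tens_map U V U' V' (f : U -> U') (g : V -> V') :
    tens U V -> tens U' V' :=
  tens_lift (fun u v => tens_pure (f u) (g v)).

Definition tens_assoc U V W : tens (tens U V) W -> tens U (tens V W) :=
  tens_lift (fun X w =>
    tens_lift (fun u v => tens_pure u (tens_pure v w)) X).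

(* (a (x) b) (c (x) d) = ac (x) bd *)
Definition tens_mul (H H' : falgType K) (X Y : tens H H') : tens H H' :=
  tens_lift (fun a b => tens_map ( *%R a) ( *%R b) Y) X.

Lemma tens_pure_is_linearl U V (v : V) :
  linear (fun u : U => tens_pure u v).
Proof.
by move=> k x y; apply/matrixP=> i j; rewrite !mxE linearP mulrDl mulrA.
Qed.

Lemma tens_pure_is_linearr U V (u : U) : linear (@tens_pure U V u).
Proof.
by move=> k x y; apply/matrixP=> i j; rewrite !mxE linearP mulrDr mulrCA.
Qed.

Lemma tens_mul_pure (H H' : falgType K) (a c : H) (b d : H') :
  tens_mul (tens_pure a b) (tens_pure c d) = tens_pure (a * c) (b * d).
Proof.
have mapE (x : H) (y : H') u v :
    tens_map ( *%R x) ( *%R y) (tens_pure u v) = tens_pure (x * u) (y * v).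
  rewrite /tens_map tens_lift_pure // => w k w1 w2.
    by rewrite mulrDr -scalerAr tens_pure_is_linearl.
  by rewrite mulrDr -scalerAr tens_pure_is_linearr.
rewrite /tens_mul tens_lift_pure ?mapE // => x k x1 x2;
  rewrite /tens_map /tens_lift scaler_sumr -big_split;
  apply: eq_bigr => i _; rewrite scaler_sumr -big_split;
  apply: eq_bigr => j _ /=; rewrite scalerA [k * _]mulrC -scalerA -scalerDr.
  by rewrite mulrDl -scalerAl tens_pure_is_linearl.
by rewrite mulrDl -scalerAl tens_pure_is_linearr.
Qed.

End Tensor.

Notation "u '*t' v" := (tens_pure u v) : ring_scope.

Section HopfGalois.
Variable K : fieldType.

Record hopf_algebra (H : falgType K) := HopfAlgebra {
  comul : 'Hom(H, tens H H);
  counit : 'Hom(H, K^o);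
  antipode : 'End(H);
  comul1 : comul 1 = 1 *t 1;
  comulM : forall x y, comul (x * y) = tens_mul (comul x) (comul y);
  counit1 : counit 1 = 1;
  counitM : forall x y, counit (x * y) = counit x * counit y;
  comulA : forall x, tens_assoc (tens_map comul id (comul x)) =
                     tens_map id comul (comul x);
  comul_counitl : forall x, tens_lift (fun u v => counit u *: v) (comul x) = x;
  comul_counitr : forall x, tens_lift (fun u v => counit v *: u) (comul x) = x;
  antipodel : forall x,
    tens_lift (fun u v => antipode u * v) (comul x) = counit x *: 1;
  antipoder : forall x,
    tens_lift (fun u v => u * antipode v) (comul x) = counit x *: 1
}.

Record hopf_galois (L : fieldExtType K) (H : falgType K) := HopfGalois {
  hg_hopf :> hopf_algebra H;
  hg_act : 'Hom(H, 'End(L));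
  hg_act1 : forall a, hg_act 1 a = a;
  hg_actM : forall h h' a, hg_act (h * h') a = hg_act h (hg_act h' a);
  hg_act_one : forall h, hg_act h 1 = counit hg_hopf h *: 1;
  hg_act_mul : forall h a b, hg_act h (a * b) =
    tens_lift (fun u v => hg_act u a * hg_act v b) (comul hg_hopf h);
  hg_bij : bijective (tens_lift (fun (a : L) (h : H) =>
                        (amull a \o hg_act h)%VF : 'End(L)))
}.

End HopfGalois.

(* The group ring L T of a permutation group T; [f t] is the coefficient of   *)
(* t. The product of T inside Perm(X) is composition: s \o t is (t * s)%g in  *)
(* MathComp, where (t * s)%g applies t first.                                 *)
Section GroupRing.
Variables (K : fieldType) (L : fieldExtType K) (X : finType).
Variable T : {group {perm X}}.

Definition permring := {ffun subg_of T -> L}.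

HB.instance Definition _ := Vector.copy permring {ffun subg_of T -> L}.

Definition pr_mono (b : L) (t : subg_of T) : permring :=
  [ffun s => if s == t then b else 0].
Definition pr_one : permring := pr_mono 1 1%g.
Definition pr_mul (f g : permring) : permring :=
  \sum_s \sum_t pr_mono (f s * g t) (t * s)%g.

Lemma pr_mulE f g u : pr_mul f g u = \sum_s f s * g (u * s^-1)%g.
Proof.
rewrite /pr_mul sum_ffunE; apply: eq_bigr => s _; rewrite sum_ffunE.
rewrite (bigD1 (u * s^-1)%g) //= ffunE mulgKV eqxx big1 ?addr0 // => t ne.
by rewrite ffunE; case: eqP => // def_u; rewrite def_u mulgK eqxx in ne.
Qed.

Fact pr_mulA : associative pr_mul.
Proof.
move=> f g h; apply/ffunP=> u; rewrite !pr_mulE.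
under eq_bigr do rewrite pr_mulE mulr_sumr.
under [RHS]eq_bigr do rewrite pr_mulE mulr_suml.
rewrite [RHS]exchange_big /=; apply: eq_bigr => s _.
rewrite (reindex_inj (mulIg (s^-1)%g)) /=; apply: eq_bigr => t _.
by rewrite mulrA invMg invgK !mulgA mulgKV.
Qed.

Fact pr_mul1l : left_id pr_one pr_mul.
Proof.
move=> f; apply/ffunP=> u; rewrite pr_mulE (bigD1 1%g) //= ffunE eqxx mul1r.
rewrite invg1 mulg1 big1 ?addr0 // => s /negPf ne.
by rewrite ffunE ne mul0r.
Qed.

Fact pr_mul1r : right_id pr_one pr_mul.
Proof.
move=> f; apply/ffunP=> u; rewrite pr_mulE (bigD1 u) //= ffunE mulgV eqxx.
rewrite mulr1 big1 ?addr0 // => s /negPf ne.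
by rewrite ffunE -(inj_eq (mulIg s)) mulgKV mul1g eq_sym ne mulr0.
Qed.

Fact pr_mulDl : left_distributive pr_mul +%R.
Proof.
move=> f g h; apply/ffunP=> u; rewrite ffunE !pr_mulE -big_split /=.
by apply: eq_bigr => s _; rewrite ffunE mulrDl.
Qed.

Fact pr_mulDr : right_distributive pr_mul +%R.
Proof.
move=> f g h; apply/ffunP=> u; rewrite ffunE !pr_mulE -big_split /=.
by apply: eq_bigr => s _; rewrite ffunE mulrDr.
Qed.

Fact pr_one_neq0 : pr_one != 0.
Proof.
by apply/eqP=> /ffunP/(_ 1%g); rewrite !ffunE eqxx; apply/eqP/oner_neq0.
Qed.

HB.instance Definition _ := GRing.Zmodule_isNzRing.Build permring
  pr_mulA pr_mul1l pr_mul1r pr_mulDl pr_mulDr pr_one_neq0.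

Fact pr_scaleAl (k : K) (f g : permring) : k *: (f * g) = (k *: f) * g.
Proof.
apply/ffunP=> u; rewrite ffunE -!/(pr_mul _ _) !pr_mulE scaler_sumr.
by apply: eq_bigr => s _; rewrite ffunE scalerAl.
Qed.

HB.instance Definition _ := GRing.Lmodule_isLalgebra.Build K permring pr_scaleAl.

Fact pr_scaleAr (k : K) (f g : permring) : k *: (f * g) = f * (k *: g).
Proof.
apply/ffunP=> u; rewrite ffunE -!/(pr_mul _ _) !pr_mulE scaler_sumr.
by apply: eq_bigr => s _; rewrite ffunE scalerAr.
Qed.

HB.instance Definition _ := GRing.Lalgebra_isAlgebra.Build K permring pr_scaleAr.
HB.instance Definition _ := Algebra_isFalgebra.Build K permring.

(* GL, the ring of functions X -> L with basis (e_z), as an LT-module. *)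
Definition fun_basis (z : X) : {ffun X -> L^o} := [ffun w => (w == z)%:R].
Definition pr_act (f : permring) (c : {ffun X -> L^o}) : {ffun X -> L^o} :=
  \sum_t \sum_z (f t * c z) *: fun_basis (sgval t z).

End GroupRing.

Definition perm_regular (X : finType) (T : {set {perm X}}) :=
  forall x y : X, exists! t : {perm X}, t \in T /\ t x = y.

Section GreitherPareigis.
Variables (K : fieldType) (L : splittingFieldType K).
Variables (A : finZmodType) (sigma : A -> gal_of {:L}).
Variable T : {group {perm A}}.

Definition lambda_plus (z : A) : {perm A} := perm (@addrI A z).

Definition normalized_by_lambda_plus :=
  lambda_plus @: [set: A] \subset 'N(T)%g.

(* G acts on L T by sigma on L and by conjugation by lambda_plus on T; note   *)
(* that (t ^ lambda_plus z)%g is lambda_plus z \o t \o (lambda_plus z)^-1.    *)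
(* It lies in T when T is normalized by lambda_plus, so that [subg T] then    *)
(* merely views it as an element of T.                                        *)
Definition gal_pr_act (z : A) (f : permring L T) : permring L T :=
  \sum_t pr_mono (sigma z (f t)) (subg T (sgval t ^ lambda_plus z)%g).

(* L -> GL, a |-> \sum_y a^y e_y *)
Definition gal_embed (a : L) : {ffun A -> L^o} :=
  \sum_y (sigma y a : L) *: fun_basis L y.

(* The image of a tensor over K in LT (x)_L LT, identified with the functions *)
(* from T * T to L.                                                           *)
Definition pr_tens (H : {aspace permring L T}) :
    tens (subvs_of H) (subvs_of H) -> {ffun subg_of T * subg_of T -> L} :=
  tens_lift (fun u v =>
    [ffun st => (vsval u : permring L T) st.1 * (vsval v : permring L T) st.2]).

(* S is the Hopf Galois structure that the regular subgroup T yields: H is    *)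
(* (LT)^G, its Hopf algebra structure is inherited from that of the group     *)
(* ring LT (t |-> t (x) t, t |-> 1, t |-> t^-1), and its action on L is       *)
(* inherited from that of LT on GL.                                           *)
Record yields_hopf_galois (H : {aspace permring L T})
    (S : hopf_galois L (subvs_of H)) : Prop := YieldsHopfGalois {
  yields_regular : perm_regular T;
  yields_normalized : normalized_by_lambda_plus;
  yields_fixed : forall f, f \in H <-> (forall z, gal_pr_act z f = f);
  yields_comul : forall h, pr_tens (comul S h) =
    [ffun st => if st.1 == st.2 then (vsval h : permring L T) st.1 else 0];
  yields_counit : forall h, (counit S h : K)%:A = 
    \sum_t (vsval h : permring L T) t;
  yields_antipode : forall h t,
    (vsval (antipode S h) : permring L T) t = (vsval h : permring L T) t^-1%g;
  yields_act : forall h a,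
    gal_embed (hg_act S h a) = pr_act (vsval h) (gal_embed a)
}.

End GreitherPareigis.

(* nmul_nil is A ^ m = 0: all products of m elements vanish. *)
Record nilpotent_ring (A : zmodType) := NilpotentRing {
  nmul :> A -> A -> A;
  nmulA : associative nmul;
  nmulDl : left_distributive nmul +%R;
  nmulDr : right_distributive nmul +%R;
  nmul_nil : exists2 m, (1 < m)%N &
    forall a s, size s = m.-1 -> foldl nmul a s = 0
}.

Section Adjoint.
Variables (A : finZmodType) (mul : nilpotent_ring A).

Definition circ (a b : A) : A := a + b + mul a b.

Lemma circA : associative circ.
Proof.
move=> a b c; rewrite /circ !nmulDr !nmulDl nmulA !addrA; congr (_ + _).
by rewrite [LHS](ACl (1*2*5*3*6*4)%AC).
Qed.

Lemma circ_inj (a : A) : injective (circ a).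
Proof.
have mul0 b : mul b 0 = 0 by apply: (addrI (mul b 0)); rewrite -nmulDr !addr0.
have mulN b c : mul b (- c) = - mul b c.
  by apply: (addrI (mul b c)); rewrite -nmulDr !subrr mul0.
move=> x y; rewrite /circ -!addrA => /addrI exy; apply/eqP; rewrite -subr_eq0.
set d := x - y; have def_d : d = - mul a d.
  rewrite /d nmulDr mulN opprD opprK.
  apply/eqP; rewrite subr_eq -addrA (addrC (mul a y)) -exy.
  by rewrite addrCA addNr addr0.
have iter_d k : exists c, d = mul (foldl mul a (nseq k a)) c.
  elim: k => [|k [c IHk]] /=; first by exists (- d); rewrite mulN.
  have shift b s : foldl mul (mul a b) s = mul a (foldl mul b s).
    by elim: s b => //= e s IHs b; rewrite -nmulA IHs.
  exists (- c); rewrite shift mulN -nmulA -IHk.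
  exact: def_d.
have [m _ nil] := nmul_nil mul.
have [c ->] := iter_d m.-1; rewrite nil ?size_nseq //.
by apply/eqP/(addrI (mul 0 c)); rewrite -nmulDl !addr0.
Qed.

Definition lambda_circ (a : A) : {perm A} := perm (@circ_inj a).

Definition circ_set := lambda_circ @: [set: A].

Lemma circ_group_set : group_set circ_set.
Proof.
have mul0l b : mul 0 b = 0 by apply: (addrI (mul 0 b)); rewrite -nmulDl !addr0.
apply/group_setP; split.
  apply/imsetP; exists 0; rewrite ?inE //; apply/permP=> x.
  by rewrite perm1 permE /circ mul0l add0r addr0.
move=> _ _ /imsetP[a _ ->] /imsetP[b _ ->]; apply/imsetP.
exists (circ b a); rewrite ?inE //; apply/permP=> x.
by rewrite permM !permE circA.
Qed.

Definition circ_group : {group {perm A}} := Group circ_group_set.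

(* \sum_x b_x lambda_circ(x), in L T *)
Definition circ_elt (K : fieldType) (L : fieldExtType K) (b : A -> L) :
    permring L circ_group :=
  \sum_x pr_mono (b x) (subg circ_group (lambda_circ x)).

End Adjoint.

(* Main.v *)
(* By Galois descent, a K-linearly independent family of G-equivariant        *)
(* functions S -> L on a finite G-set S is L-linearly independent, and the    *)
(* equivariant functions span L^S over L, so they form a K-space of dimension *)
(* #|S|. For S = T with G acting by conjugation this space is H = (LT)^G, and *)
(* H (x) H is the space of equivariant functions on T * T: the coproduct is   *)
(* the preimage of (s, t) |-> [s = t] h(s). All the Hopf algebra axioms can   *)
(* then be checked on functions on T, T * T and T * (T * T). The bijectivity  *)
(* of L (x) H -> End_K(L) is Dedekind's independence of characters plus a     *)
(* dimension count, as t |-> t^-1(0) is a bijection from T to G.              *)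
(* For T = lambda_circ(A), A^3 = 0 gives the two identities behind the        *)
(* explicit formulas: conjugation by lambda_plus z sends lambda_circ x to     *)
(* lambda_circ (x - x z), and the circ-inverse of x is - x + x^2.             *)

From HB Require Import structures.
Require Import Defs.
From mathcomp Require Import all_boot all_order all_algebra.
From mathcomp Require Import all_fingroup all_solvable all_field.

Set Implicit Arguments.
Unset Strict Implicit.
Unset Printing Implicit Defensive.

Import GroupScope GRing.Theory.
Local Open Scope ring_scope.

(** * Bilinear liftings *)

(** Everything is turned into identities between L-valued functions on finite sets. An element of H
    is an equivariant function on T. [equivariant_free] and [equivariant_span] are the two halves of
    descent: independence over K implies independence over L, and equivariant functions span all
    functions over L. Hence a K-space embedded in the equivariant functions on S has L-independent
    basis images ([embedding_free]) and, if its dimension is the size of S, contains all of them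
    ([embedding_onto]). So tensors may be compared as functions ([tens_ffun_inj]), and the coproduct
    exists because the diagonal function of h is equivariant on T * T ([fr_tens_comul]); each Hopf
    axiom is then a finite sum. The action is read off at the point 0 of G: h sends a to the sum of
    h(t) times the image of a under [sigma (t^-1 0)]. [sigma_fr_act] shows that the other points
    carry the same information, which gives both the module law and agreement with the action on GL.
    [fr_canonical_inj] with a dimension count gives bijectivity. The explicit formulas come from
    [lambda_circJ] and [lambda_circV0]. *)

Section TensorLift.
Variables (K : fieldType) (U V : vectType K).

Lemma eq_tens_lift (W : lmodType K) (b b' : U -> V -> W) :
  b =2 b' -> tens_lift b =1 tens_lift b'.
Proof.
by move=> eq_b X; apply: eq_bigr => i _; apply: eq_bigr => j _; rewrite eq_b.
Qed.

Lemma tens_lift0 (W : lmodType K) (X : tens U V) :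
  tens_lift (fun _ _ => 0 : W) X = 0.
Proof.
by rewrite /tens_lift big1 // => i _; rewrite big1 // => j _; apply: scaler0.
Qed.

Lemma linear_tens_lift (W W' : lmodType K) (f : {linear W -> W'})
    (b : U -> V -> W) X :
  f (tens_lift b X) = tens_lift (fun u v => f (b u v)) X.
Proof.
rewrite /tens_lift linear_sum; apply: eq_bigr => i _.
by rewrite linear_sum; apply: eq_bigr => j _; rewrite linearZ.
Qed.

Lemma tens_liftE (W : lmodType K) (S : finType) (b : U -> V -> {ffun S -> W})
    X s :
  tens_lift b X s = tens_lift (fun u v => b u v s) X.
Proof.
rewrite /tens_lift sum_ffunE; apply: eq_bigr => i _.
by rewrite sum_ffunE; apply: eq_bigr => j _; rewrite ffunE.
Qed.

Lemma tens_lift_sum (W : lmodType K) (I : finType) (P : pred I)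
    (b : I -> U -> V -> W) X :
  tens_lift (fun u v => \sum_(i | P i) b i u v) X =
  \sum_(i | P i) tens_lift (b i) X.
Proof.
rewrite /tens_lift [RHS]exchange_big; apply: eq_bigr => k _.
by rewrite [RHS]exchange_big; apply: eq_bigr => j _; rewrite scaler_sumr.
Qed.

Lemma tens_lift_mulr (L : falgType K) (b : U -> V -> L) c X :
  tens_lift (fun u v => b u v * c) X = tens_lift b X * c.
Proof.
rewrite /tens_lift mulr_suml; apply: eq_bigr => i _; rewrite mulr_suml.
by apply: eq_bigr => j _; rewrite scalerAl.
Qed.

Lemma tens_lift_mull (L : falgType K) (b : U -> V -> L) c X :
  tens_lift (fun u v => c * b u v) X = c * tens_lift b X.
Proof.
rewrite /tens_lift mulr_sumr; apply: eq_bigr => i _; rewrite mulr_sumr.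
by apply: eq_bigr => j _; rewrite scalerAr.
Qed.

End TensorLift.

(** * Galois descent *)

Section Descent.
Variables (K : fieldType) (L : splittingFieldType K) (gT : finGroupType).
Variable sigma : {morphism [set: gT] >-> gal_of {:L}}.
Hypothesis galL : galois 1%VS {:L}.
Hypothesis isoG : isom [set: gT] 'Gal({:L} / 1%VS) sigma.

(** A K-linear left inverse of the embedding of K in L. It is defined on all of L, but its value is
    meaningful only on the line [1%VS]. *)
Definition scal (a : L) : K := coord [tuple (1 : L)] ord0 a.

Lemma scal_is_linear : linear (scal : L -> K^o).
Proof. by move=> k a b; rewrite /scal linearP. Qed.

HB.instance Definition _ :=
  GRing.isLinear.Build K L K^o _ scal scal_is_linear.

Lemma scalK (k : K) : scal k%:A = k.
Proof.
have free1 : free [tuple (1 : L)] by rewrite seq1_free oner_neq0.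
rewrite /scal linearZ /= -[X in coord _ _ X]/([tuple (1 : L)]`_(@ord0 0)).
by rewrite coord_free // eqxx mulr1.
Qed.

Lemma scal1K (a : L) : a \in 1%VS -> (scal a)%:A = a.
Proof. by case/vlineP=> k ->; rewrite scalK. Qed.

Lemma sigma1 a : sigma 1%g a = a.
Proof. by rewrite morph1 gal_id. Qed.

Lemma sigmaM x y a : sigma (x * y)%g a = sigma y (sigma x a).
Proof. by rewrite morphM ?inE // galM ?memvf. Qed.

Lemma sigma_scale z (k : K) a : sigma z (k *: a) = k *: sigma z a.
Proof. exact: linearZ. Qed.

Lemma sigma_injective : injective sigma.
Proof.
by move=> x y; case/isomP: isoG => /injmP inj _ /inj; apply; rewrite inE.
Qed.

(** Dedekind's independence of characters, with the automorphisms indexed through [sigma]. *)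
Lemma sigma_independent (c : gT -> L) :
  (forall a, \sum_z c z * sigma z a = 0) -> forall z, c z = 0.
Proof.
move=> c0 z; have /isomP[inj _] := isoG.
pose c' g := c (invm inj g).
have c'E x : c' (sigma x) = c x by rewrite /c' invmE ?inE.
rewrite -c'E; apply: (@gal_independent _ _ _ [in sigma @: [set: gT]]).
  move=> a _; rewrite -[RHS](c0 a) big_imset /=; last first.
    by move=> x y _ _ /sigma_injective.
  by apply: eq_big => [x|x _]; rewrite ?inE ?c'E.
by rewrite /= imset_f ?inE.
Qed.

Lemma fixed_in_base a : (forall z, sigma z a = a) -> a \in 1%VS.
Proof.
move=> fix_a; rewrite -(galois_fixedField galL).
apply/(fixedFieldP (memvf a)) => g Gg.
case/isomP: isoG => _ im; move: Gg; rewrite -im => /morphimP[z _ _ ->].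
exact: fix_a.
Qed.

Lemma trace_in_base a : \sum_z sigma z a \in 1%VS.
Proof.
apply: fixed_in_base => w; rewrite rmorph_sum /=.
by rewrite [RHS](reindex_inj (mulIg w)); apply: eq_bigr => z _; rewrite sigmaM.
Qed.

(** A row of the kernel of the evaluation matrix is an L-linear relation between the functions. The
    matrix form lets dimensions be compared by rank. *)
Lemma row_free_evaluation n (S : finType) (e : 'I_n -> S -> L) :
    (forall c : 'I_n -> L, (forall s, \sum_i c i * e i s = 0) ->
       forall i, c i = 0) ->
  row_free (\matrix_(i < n, j < #|S|) e i (enum_val j)).
Proof.
set M := (\matrix_(i, j) _) => free_e.
rewrite -kermx_eq0; apply/eqP/row_matrixP=> k; rewrite row0.
set c := row k _; have cM : c *m M = 0 by rewrite -row_mul mulmx_ker row0.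
apply/rowP=> i; rewrite [RHS]mxE; apply: free_e => {i} s.
have := congr1 (fun N : 'rV_#|S| => N 0 (enum_rank s)) cM.
rewrite !mxE => rel; rewrite -[RHS]rel.
by apply: eq_bigr => j _; rewrite [M _ _]mxE enum_rankK.
Qed.

(** * Equivariant functions: independence and span over L *)

Section Equivariant.
Variables (S : finType) (to : {action gT &-> S}).

Definition equivariant (f : S -> L) := forall z s, f (to s z) = sigma z (f s).

(* Artin's argument: averaging a linear relation over [L] against all         *)
(* [a : L] makes its coefficients traces, which lie in [K].                   *)
Lemma equivariant_free (n : nat) (e : 'I_n -> S -> L) :
    (forall i, equivariant (e i)) ->
    (forall k : 'I_n -> K, (forall s, \sum_i k i *: e i s = 0) ->
       forall i, k i = 0) ->
  forall c : 'I_n -> L, (forall s, \sum_i c i * e i s = 0) -> forall i, c i = 0.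
Proof.
move=> eqv freeK c rel.
have tr0 a i : \sum_z sigma z (a * c i) = 0.
  rewrite -(scal1K (trace_in_base _)).
  rewrite (freeK (fun i => scal (\sum_z sigma z (a * c i)))) ?scale0r // => s.
  under eq_bigr do rewrite -mulr_algl (scal1K (trace_in_base _)) mulr_suml.
  rewrite exchange_big big1 // => z _ /=.
  (* The relation is taken at the translate of [s] by the inverse of [z], so that applying [sigma z]
     brings [e i] back to the point [s]. *)
  have := congr1 (fun b => sigma z (a * b)) (rel (to s z^-1%g)).
  rewrite mulr_sumr rmorph_sum mulr0 rmorph0 => rel0; rewrite -[RHS]rel0.
  apply: eq_bigr => i' _; rewrite mulrA [RHS]rmorphM; congr (_ * _).
  by rewrite -[RHS]eqv -actM mulVg act1.
(* All traces of [a * c i] vanish, so independence of the [sigma z] kills every [sigma z (c i)]; the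
   identity element gives [c i]. *)
move=> i; rewrite -(sigma1 (c i)).
apply: (sigma_independent (c := fun z => sigma z (c i))) => a.
by rewrite -[RHS](tr0 a i); apply: eq_bigr => z _; rewrite rmorphM mulrC.
Qed.

(** Averaging [b i * f] over the group, for a K-basis [b] of L, gives equivariant functions. The
    matrix of the [sigma z (b i)] has a left inverse, whose row at the identity combines the
    averages so that only the term of the identity, [f] itself, survives. *)
Lemma equivariant_span (f : S -> L) :
  exists n (c : 'I_n -> L) (h : 'I_n -> S -> L),
    (forall i, equivariant (h i)) /\ forall s, f s = \sum_i c i * h i s.
Proof.
pose n := \dim {:L}; pose b (i : 'I_n) := (vbasis {:L})`_i.
pose D : 'M[L]_(n, #|gT|) := \matrix_(i, j) sigma (enum_val j) (b i).
(* A relation between the columns says that a combination of the [sigma z] vanishes on a basis of L,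
   hence everywhere. *)
have fullD : row_full D.
  rewrite -[row_full D]/(\rank D == _) -mxrank_tr -[_ == _]/(row_free D^T).
  rewrite -kermx_eq0; apply/eqP/row_matrixP=> k; rewrite row0.
  set c := row k _; have cD : c *m D^T = 0 by rewrite -row_mul mulmx_ker row0.
  apply/rowP=> j; rewrite [RHS]mxE -[j]enum_valK; move: (enum_val j).
  apply: (sigma_independent (c := fun z => c 0 (enum_rank z))) => a.
  rewrite (coord_vbasis (memvf a)).
  under eq_bigr do rewrite linear_sum mulr_sumr.
  rewrite exchange_big big1 // => i _ /=.
  transitivity (coord (vbasis {:L}) i a *: (c *m D^T) 0 i).
    rewrite mxE (reindex enum_rank) /=; last first.
      by exists enum_val => ? _; rewrite (enum_rankK, enum_valK).
    rewrite scaler_sumr; apply: eq_bigr => z _.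
    by rewrite !mxE enum_rankK linearZ /= -scalerAr.
  by rewrite cD mxE scaler0.
case/row_fullP: fullD => B BD.
exists n, (fun i => B (enum_rank 1%g) i).
exists (fun i s => \sum_z sigma z (b i * f (to s z^-1%g))); split.
  move=> i w s; rewrite rmorph_sum (reindex_inj (mulIg w)) /=.
  apply: eq_bigr => z _; rewrite sigmaM; congr (sigma w (sigma z (_ * f _))).
  by rewrite -actM invMg mulKVg.
move=> s; under eq_bigr do rewrite mulr_sumr.
rewrite exchange_big /=.
transitivity (\sum_z (B *m D) (enum_rank 1%g) (enum_rank z) *
                sigma z (f (to s z^-1%g))).
  rewrite BD (bigD1 1%g) //= !mxE eqxx mul1r sigma1 invg1 act1 big1 ?addr0 //.
  move=> z nz; rewrite mxE (inj_eq enum_rank_inj) eq_sym (negPf nz).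
  by rewrite mul0r.
apply: eq_bigr => z _; rewrite mxE mulr_suml; apply: eq_bigr => i _.
by rewrite mxE enum_rankK rmorphM mulrA.
Qed.

End Equivariant.

(** * The dimension of the space of equivariant functions *)

Section EquivariantSpace.
Variables (S : finType) (to : {action gT &-> S}).

(** Written as a linear map so that the equivariant functions form its kernel, hence a
    K-subspace. *)
Definition equivariant_defect (f : {ffun S -> L}) : {ffun S * gT -> L} :=
  [ffun sz => f (to sz.1 sz.2) - sigma sz.2 (f sz.1)].

Fact equivariant_defect_is_linear : linear equivariant_defect.
Proof.
move=> k f g; apply/ffunP=> sz; rewrite !ffunE linearP scalerBr.
by rewrite opprD addrACA.
Qed.

HB.instance Definition _ :=
  GRing.isLinear.Build K {ffun S -> L} {ffun S * gT -> L} _ equivariant_defect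
    equivariant_defect_is_linear.

Definition equivariant_space := lker (linfun equivariant_defect).

Lemma mem_equivariant_space f : f \in equivariant_space <-> equivariant to f.
Proof.
rewrite memv_ker lfunE; split=> [/eqP/ffunP eqv_f z s | eqv_f].
  by have := eqv_f (s, z); rewrite !ffunE => /eqP; rewrite subr_eq0 => /eqP.
by apply/eqP/ffunP=> [[s z]]; rewrite !ffunE eqv_f subrr.
Qed.

(** The evaluation matrix of a K-basis is row free by [equivariant_free] and row full by
    [equivariant_span], hence square. *)
Lemma dim_equivariant_space : \dim equivariant_space = #|S|.
Proof.
set V := equivariant_space; have defV := mem_equivariant_space.
pose e (i : 'I_(\dim V)) : {ffun S -> L} := (vbasis V)`_i.
have eqv i : equivariant to (e i).
  by apply/defV; apply: vbasis_mem; rewrite mem_nth ?size_tuple.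
pose M : 'M[L]_(\dim V, #|S|) := \matrix_(i, j) e i (enum_val j).
have freeM : row_free M.
  apply: (row_free_evaluation (e := e)).
  apply: (equivariant_free (e := e) eqv) => k rel i.
  have /freeP := basis_free (vbasisP V); apply.
  apply/ffunP=> s; rewrite sum_ffunE ffunE -[RHS](rel s).
  by apply: eq_bigr => j _; rewrite ffunE.
have fullM : row_full M.
  rewrite -sub1mx; apply/row_subP=> j; rewrite row1.
  (* Each unit row is the indicator function of a point, an L-combination of equivariant functions,
     and these are K-combinations of the basis. *)
  pose f s : L := (s == enum_val j)%:R.
  have [n [c [h [eqvh def_f]]]] := equivariant_span to f.
  have -> : delta_mx 0 j =
      \sum_i c i *: (\row_l h i (enum_val l)) :> 'rV[L]_#|S|.
    apply/rowP=> l; rewrite summxE mxE eqxx /=.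
    rewrite -(inj_eq enum_val_inj) -[LHS]/(f (enum_val l)) def_f.
    by apply: eq_bigr => i _; rewrite !mxE.
  apply: summx_sub => i _; apply: scalemx_sub.
  pose g : {ffun S -> L} := [ffun s => h i s].
  have Vg : g \in V by apply/defV => z s; rewrite !ffunE eqvh.
  apply/submxP; exists (\row_k (coord (vbasis V) k g)%:A).
  apply/rowP=> l; rewrite !mxE -[LHS](ffunE (h i)) -/g {1}(coord_vbasis Vg).
  by rewrite sum_ffunE; apply: eq_bigr => k _; rewrite !mxE ffunE mulr_algl.
by apply/eqP; rewrite -(eqP freeM) -[_ == _]/(row_full M).
Qed.

End EquivariantSpace.

(** * K-spaces embedded in equivariant functions *)

Section Embedding.
Variables (V : vectType K) (S : finType) (to : {action gT &-> S}).
Variable phi : {linear V -> {ffun S -> L}}.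
Hypothesis phi_eqv : forall v, equivariant to (phi v).
Hypothesis phi_inj : injective phi.

Lemma embedding_free (c : 'I_(\dim {:V}) -> L) :
  (forall s, \sum_i c i * phi (vbasis {:V})`_i s = 0) -> forall i, c i = 0.
Proof.
apply: (@equivariant_free _ to _ (fun i => phi (vbasis {:V})`_i)) => // k rel.
have /freeP := basis_free (vbasisP {:V}); apply; apply: phi_inj.
rewrite linear_sum linear0; apply/ffunP=> s.
rewrite sum_ffunE ffunE -[RHS](rel s).
by apply: eq_bigr => i _; rewrite linearZ ffunE.
Qed.

(** By the dimension hypothesis the images of a K-basis form an L-basis of all functions.
    Equivariance of [f] forces its coordinates to be Galois-invariant, hence to lie in K. *)
Lemma embedding_onto (f : S -> L) :
  \dim {:V} = #|S| -> equivariant to f -> exists v, phi v =1 f.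
Proof.
move=> dimV f_eqv; pose e i := phi (vbasis {:V})`_i.
pose M : 'M[L]_(\dim {:V}, #|S|) := \matrix_(i, j) e i (enum_val j).
have freeM : row_free M.
  by apply: (row_free_evaluation (e := e)); apply: embedding_free.
have fullM : row_full M by rewrite /row_full (eqP freeM) dimV.
have /submxP[c def_f] : (\row_j f (enum_val j) <= M)%MS by apply: submx_full.
have fE s : f s = \sum_i c 0 i * e i s.
  have := congr1 (fun N : 'rV_#|S| => N 0 (enum_rank s)) def_f.
  rewrite !mxE enum_rankK => ->.
  by apply: eq_bigr => i _; rewrite mxE enum_rankK.
(* Applying [sigma z] to the expansion of [f] gives another expansion of [f]; uniqueness of
   coordinates shows that they are fixed. *)
have c_base i : c 0 i \in 1%VS.
  apply: fixed_in_base => z; apply/eqP; rewrite -subr_eq0; apply/eqP.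
  move: i; apply: embedding_free => s; apply/eqP.
  under eq_bigr do rewrite mulrBl.
  rewrite sumrB subr_eq0 -fE; apply/eqP.
  have := congr1 (sigma z) (fE (to s z^-1%g)).
  rewrite -f_eqv -actM mulVg act1 rmorph_sum => ->; apply: eq_bigr => i _.
  by rewrite rmorphM; congr (_ * _); rewrite -[RHS]phi_eqv -actM mulVg act1.
exists (\sum_i scal (c 0 i) *: (vbasis {:V})`_i) => s.
rewrite fE linear_sum sum_ffunE; apply: eq_bigr => i _.
by rewrite linearZ ffunE -mulr_algl scal1K.
Qed.

End Embedding.

(** * Tensors over K as functions on a product *)

Section TensorEmbedding.
Variables (U V : vectType K) (S S' : finType).
Variables (to : {action gT &-> S}) (to' : {action gT &-> S'}).
Variables (phi : {linear U -> {ffun S -> L}}).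
Variables (psi : {linear V -> {ffun S' -> L}}).

Definition pair_act (s : S * S') z := (to s.1 z, to' s.2 z).

Fact pair_act1 : pair_act^~ 1%g =1 id.
Proof. by case=> s s'; rewrite /pair_act !act1. Qed.

Fact pair_actM s : act_morph pair_act s.
Proof. by move=> z w; rewrite /pair_act !actM. Qed.

Canonical pair_action := TotalAction pair_act1 pair_actM.

Definition tens_ffun : {linear tens U V -> {ffun S * S' -> L}} :=
  tens_lift (fun u v => [ffun st => phi u st.1 * psi v st.2]).

Lemma tens_ffunE X st :
  tens_ffun X st = tens_lift (fun u v => phi u st.1 * psi v st.2) X.
Proof. by rewrite tens_liftE; apply: eq_tens_lift => u v; rewrite ffunE. Qed.

Lemma tens_ffun_pure u v st :
  tens_ffun (u *t v) st = phi u st.1 * psi v st.2.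
Proof.
rewrite tens_ffunE tens_lift_pure // => [w k x y | w k x y].
  by rewrite linearP !ffunE mulrDl scalerAl.
by rewrite linearP !ffunE mulrDr scalerAr.
Qed.

Hypothesis phi_eqv : forall u, equivariant to (phi u).
Hypothesis psi_eqv : forall v, equivariant to' (psi v).

Lemma tens_ffun_eqv X : equivariant pair_action (tens_ffun X).
Proof.
move=> z [s s']; rewrite !tens_ffunE /tens_lift rmorph_sum.
apply: eq_bigr => i _; rewrite rmorph_sum; apply: eq_bigr => j _.
by rewrite phi_eqv psi_eqv [RHS]sigma_scale; congr (_ *: _); apply/esym/rmorphM.
Qed.

(** [embedding_free] is used once in each variable: the coordinates of a tensor with zero image are
    the coefficients of a double L-linear relation. *)
Lemma tens_ffun_inj : injective phi -> injective psi -> injective tens_ffun.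
Proof.
move=> phi_inj psi_inj; apply: raddf_inj => X X0; apply/matrixP=> i j.
rewrite [RHS]mxE; apply: (can_inj scalK); rewrite scale0r; move: j.
apply: (embedding_free psi_eqv psi_inj) => s'; move: i.
apply: (embedding_free phi_eqv phi_inj) => s.
transitivity (tens_ffun X (s, s')); last by rewrite X0 ffunE.
rewrite tens_ffunE; apply: eq_bigr => i _; rewrite mulr_suml.
apply: eq_bigr => j _.
by rewrite mulrAC mulr_algl -scalerAl.
Qed.

End TensorEmbedding.

End Descent.

(** * The Hopf Galois structure given by a regular subgroup *)

Section FixedRing.
Variables (K : fieldType) (L : splittingFieldType K) (A : finZmodType).
Variable sigma : {morphism [set: A] >-> gal_of {:L}}.
Variable T : {group {perm A}}.
Hypothesis galL : galois 1%VS {:L}.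
Hypothesis isoG : isom [set: A] 'Gal({:L} / 1%VS) sigma.
Hypothesis normT : normalized_by_lambda_plus T.

(** [subg] has a default value outside T; normalization by [lambda_plus] ensures that it never
    occurs here. *)
Lemma sgvalJ (t : subg_of T) z :
  sgval (subg T (sgval t ^ lambda_plus z)%g) = (sgval t ^ lambda_plus z)%g.
Proof.
apply: subgK; rewrite memJ_norm ?subgP //.
by apply: (subsetP normT); rewrite imset_f ?inE.
Qed.

Definition conj_act (t : subg_of T) (z : A) : subg_of T :=
  subg T (sgval t ^ lambda_plus z)%g.

Lemma lambda_plusD (z w : A) :
  lambda_plus (z + w) = (lambda_plus z * lambda_plus w)%g.
Proof. by apply/permP=> x; rewrite permM !permE addrA (addrC z). Qed.

Fact conj_act1 : conj_act^~ 1%g =1 id.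
Proof.
have lambda_plus0 : lambda_plus (0 : A) = 1%g.
  by apply/permP=> x; rewrite permE perm1 add0r.
move=> t; apply: val_inj; rewrite /= sgvalJ -[RHS]conjg1; congr (_ ^ _)%g.
exact: lambda_plus0.
Qed.

Fact conj_actM t : act_morph conj_act t.
Proof.
by move=> z w; apply: val_inj; rewrite /= !sgvalJ lambda_plusD conjgM.
Qed.

Definition conj_action := TotalAction conj_act1 conj_actM.

Lemma conj_actionM (s t : subg_of T) z :
  conj_action (s * t)%g z = (conj_action s z * conj_action t z)%g.
Proof. by apply: val_inj; rewrite /= !sgvalJ conjMg. Qed.

Lemma conj_actionV (t : subg_of T) z :
  conj_action t^-1%g z = (conj_action t z)^-1%g.
Proof. by apply: val_inj; rewrite /= !sgvalJ conjVg. Qed.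

Lemma gal_pr_actE z (f : permring L T) t :
  gal_pr_act sigma z f (conj_action t z) = sigma z (f t).
Proof.
rewrite /gal_pr_act sum_ffunE (bigD1 t) //= ffunE eqxx big1 ?addr0 // => s ne.
rewrite ffunE; case: eqP => // /(act_inj conj_action) eq_ts.
by rewrite eq_ts eqxx in ne.
Qed.

(** The action of [z] moves the coefficient at [t], twisted by [sigma z], to the conjugate of [t].
    Being fixed is thus equivariance of the coefficients, which makes descent applicable to H. *)
Lemma gal_pr_act_fixed (f : permring L T) :
  equivariant sigma conj_action f <-> (forall z, gal_pr_act sigma z f = f).
Proof.
split=> [eqv z | fix_f z t]; last by rewrite -[in LHS](fix_f z) gal_pr_actE.
apply/ffunP=> t; rewrite -(actKVin conj_action (in_setT z) t).
by rewrite gal_pr_actE [RHS]eqv.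
Qed.

Definition fixed_space : {vspace permring L T} :=
  equivariant_space sigma conj_action.

Lemma mem_fixed_space (f : permring L T) :
  f \in fixed_space <-> equivariant sigma conj_action f.
Proof. exact: mem_equivariant_space. Qed.

Lemma permring1E t : (1 : permring L T) t = (t == 1%g)%:R.
Proof. by rewrite ffunE; case: eqP. Qed.

Lemma permringM (f g : permring L T) t :
  (f * g) t = \sum_s f s * g (t * s^-1)%g.
Proof. exact: pr_mulE. Qed.

Lemma fixed_space1 : 1 \in fixed_space.
Proof.
apply/mem_fixed_space=> z t; rewrite !permring1E.
have conj1 : conj_action 1%g z = 1%g.
  by apply: (mulgI (conj_action 1 z)%g); rewrite -conj_actionM !mulg1.
by rewrite -[in LHS]conj1 (inj_eq (act_inj conj_action z)) rmorph_nat.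
Qed.

(** Conjugation is an automorphism of T, so the convolution sum can be reindexed along it. *)
Lemma fixed_spaceM : {in fixed_space &, forall f g, f * g \in fixed_space}.
Proof.
move=> f g /mem_fixed_space eqv_f /mem_fixed_space eqv_g.
apply/mem_fixed_space => z t; rewrite !permringM rmorph_sum.
rewrite (reindex_inj (act_inj conj_action z)); apply: eq_bigr => s _.
by rewrite -conj_actionV -conj_actionM eqv_f eqv_g [RHS]rmorphM.
Qed.

Fact fixed_space_is_aspace : is_aspace fixed_space.
Proof.
by rewrite /is_aspace has_algid1 ?fixed_space1 //; apply/prodvP/fixed_spaceM.
Qed.

Definition fixed_ring : {aspace permring L T} := ASpace fixed_space_is_aspace.

Lemma mem_fixed_ring (f : permring L T) :
  f \in fixed_ring <-> equivariant sigma conj_action f.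
Proof. exact: mem_fixed_space. Qed.

Local Notation H := (subvs_of fixed_ring).

Definition fr_val : {linear H -> {ffun subg_of T -> L}} := vsval.

Lemma fr_val_eqv h : equivariant sigma conj_action (fr_val h).
Proof. exact/mem_fixed_ring/subvsP. Qed.

Lemma fr_val_inj : injective fr_val.
Proof. exact: subvs_inj. Qed.

Lemma fr_val1 t : fr_val 1 t = (t == 1%g)%:R.
Proof.
rewrite -permring1E -[fr_val 1]/(algid fixed_ring).
by have /eqP-> : algid fixed_ring == 1 by rewrite algid_eq1 fixed_space1.
Qed.

Lemma fr_valM x y t :
  fr_val (x * y) t = \sum_s fr_val x s * fr_val y (t * s^-1)%g.
Proof. exact: permringM. Qed.

Lemma dim_fixed_ring : \dim {:H} = #|subg_of T|.
Proof.
rewrite dimvf; exact: dim_equivariant_space.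
Qed.

(** * The coproduct *)

Definition fr_tens : {linear tens H H -> {ffun subg_of T * subg_of T -> L}} :=
  tens_ffun fr_val fr_val.

Lemma fr_tens_inj : injective fr_tens.
Proof.
exact: (tens_ffun_inj galL isoG fr_val_eqv fr_val_eqv fr_val_inj fr_val_inj).
Qed.

Definition diag (h : H) : {ffun subg_of T * subg_of T -> L} :=
  [ffun st => if st.1 == st.2 then fr_val h st.1 else 0].

Fact diag_is_linear : linear diag.
Proof.
move=> k x y; apply/ffunP=> st; rewrite !ffunE.
by case: eqP => _; rewrite ?linearP ?ffunE // scaler0 addr0.
Qed.

HB.instance Definition _ :=
  GRing.isLinear.Build K H {ffun subg_of T * subg_of T -> L} _ diag
    diag_is_linear.

(** The inverse of [fr_tens] is a true section only on the image; [fr_tens_comul] shows that the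
    diagonal functions lie there. *)
Definition fr_comul : 'Hom(H, tens H H) :=
  ((linfun fr_tens)^-1 \o linfun diag)%VF.

(** The diagonal of T * T is stable under conjugation, so [diag h] is equivariant, and the dimension
    of H (x) H is the size of T * T; [embedding_onto] applies. *)
Lemma fr_tens_comul h : fr_tens (fr_comul h) = diag h.
Proof.
have dimHH : \dim {:tens H H} = #|{: subg_of T * subg_of T}|.
  by rewrite dimvf card_prod -dim_fixed_ring.
have eqv : equivariant sigma (pair_action conj_action conj_action) (diag h).
  move=> z [s t]; rewrite !ffunE /= (inj_eq (act_inj conj_action z)).
  by case: eqP => _; rewrite ?rmorph0 //; apply: fr_val_eqv.
have [X def_X] := embedding_onto galL isoG
  (tens_ffun_eqv fr_val_eqv fr_val_eqv) fr_tens_inj dimHH eqv.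
rewrite comp_lfunE -[LHS](lfunE fr_tens) limg_lfunVK; first exact: lfunE.
have -> : linfun diag h = linfun fr_tens X.
  by rewrite !lfunE; apply/ffunP=> st; rewrite -def_X.
exact: memv_img (memvf X).
Qed.

Lemma fr_comulE h s t :
  tens_lift (fun u v => fr_val u s * fr_val v t) (fr_comul h) =
  if s == t then fr_val h s else 0.
Proof.
transitivity (fr_tens (fr_comul h) (s, t)); first by rewrite tens_ffunE.
by rewrite fr_tens_comul ffunE.
Qed.

Lemma fr_comul1 : fr_comul 1 = 1 *t 1.
Proof.
apply: fr_tens_inj; rewrite fr_tens_comul; apply/ffunP=> [[s t]].
rewrite ffunE tens_ffun_pure !fr_val1 /= -natrM mulnb.
case: (s =P t) => [-> | ne_st]; first by rewrite andbb.
by case: eqP => // s1; case: eqP => // t1; case: ne_st; rewrite s1 t1.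
Qed.

(** [fr_tens] turns the product of H (x) H into convolution on T * T. *)
Lemma fr_tens_mul X Y s t :
  fr_tens (tens_mul X Y) (s, t) =
  \sum_u \sum_v fr_tens X (u, v) * fr_tens Y (s * u^-1, t * v^-1)%g.
Proof.
rewrite /tens_mul linear_tens_lift tens_liftE.
under eq_bigr do under eq_bigr do
  rewrite [fr_tens X _]tens_ffunE -tens_lift_mulr.
under eq_bigr do rewrite -tens_lift_sum.
rewrite -tens_lift_sum; apply: eq_tens_lift => a b.
rewrite /tens_map linear_tens_lift tens_liftE.
under [RHS]eq_bigr do under eq_bigr do
  rewrite [fr_tens Y _]tens_ffunE -tens_lift_mull.
under [RHS]eq_bigr do rewrite -tens_lift_sum.
rewrite -tens_lift_sum; apply: eq_tens_lift => c d.
rewrite tens_ffun_pure !fr_valM mulr_suml; apply: eq_bigr => u _.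
by rewrite mulr_sumr; apply: eq_bigr => v _; rewrite mulrACA.
Qed.

Lemma fr_comulM x y : fr_comul (x * y) = tens_mul (fr_comul x) (fr_comul y).
Proof.
apply: fr_tens_inj; rewrite fr_tens_comul; apply/ffunP=> [[s t]].
rewrite ffunE fr_tens_mul !fr_tens_comul fr_valM /=.
(* Only the terms with [u = v] survive in the double sum, and right translation by the inverse of
   [u] preserves both equality and inequality of [s] and [t]. *)
transitivity (\sum_u fr_val x u * diag y (s * u^-1, t * u^-1)%g).
  case: (s =P t) => [-> | ne_st].
    by apply: eq_bigr => u _; rewrite ffunE eqxx.
  rewrite big1 // => u _; rewrite ffunE /= (inj_eq (mulIg _)).
  by case: eqP ne_st => // _ _; rewrite mulr0.
apply: eq_bigr => u _; rewrite (bigD1 u) //= !ffunE eqxx big1 ?addr0 //.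
by move=> v ne_vu; rewrite !ffunE /= eq_sym (negPf ne_vu) mul0r.
Qed.

Definition fr_tens3 :
    {linear tens H (tens H H) ->
      {ffun subg_of T * (subg_of T * subg_of T) -> L}} :=
  tens_ffun fr_val fr_tens.

Lemma fr_tens3_inj : injective fr_tens3.
Proof.
exact: (tens_ffun_inj galL isoG fr_val_eqv
  (tens_ffun_eqv fr_val_eqv fr_val_eqv) fr_val_inj fr_tens_inj).
Qed.

Lemma fr_tens3_assoc X v s t r :
  fr_tens3 (tens_assoc (X *t v)) (s, (t, r)) =
  fr_tens X (s, t) * fr_val v r.
Proof.
rewrite /tens_assoc tens_lift_pure; last 2 first.
- move=> w k x y; exact: linearP.
- move=> X0 k x y; rewrite /tens_lift scaler_sumr -big_split /=.
  apply: eq_bigr => i _; rewrite scaler_sumr -big_split; apply: eq_bigr => j _.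
  by rewrite /= !tens_pure_is_linearr scalerDr !scalerA (mulrC k).
rewrite linear_tens_lift tens_liftE [fr_tens X _]tens_ffunE -tens_lift_mulr.
by apply: eq_tens_lift => a b; rewrite !tens_ffun_pure mulrA.
Qed.

(** Both sides are the function on T * (T * T) that equals x(s) when [s = t = r] and vanishes
    elsewhere. *)
Lemma fr_comulA x :
  tens_assoc (tens_map fr_comul id (fr_comul x)) =
  tens_map id fr_comul (fr_comul x).
Proof.
apply: fr_tens3_inj; apply/ffunP=> [[s [t r]]].
rewrite /tens_map [tens_assoc _]linear_tens_lift !linear_tens_lift !tens_liftE.
transitivity (if s == t then if s == r then fr_val x s else 0 else 0).
  rewrite -fr_comulE; case: (s =P t) => [<- | ne_st].
    apply: eq_tens_lift => u v; rewrite fr_tens3_assoc fr_tens_comul ffunE /=.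
    by rewrite eqxx.
  rewrite -[RHS](tens_lift0 _ (fr_comul x)); apply: eq_tens_lift => u v.
  by rewrite fr_tens3_assoc fr_tens_comul ffunE /=; case: eqP; rewrite ?mul0r.
rewrite -(fr_comulE x s r); case: (t =P r) => [<- | ne_tr].
  rewrite fr_comulE; transitivity (if s == t then fr_val x s else 0).
    by case: eqP.
  rewrite -fr_comulE; apply: eq_tens_lift => u v.
  by rewrite tens_ffun_pure fr_tens_comul ffunE eqxx.
rewrite fr_comulE; transitivity (0 : L).
  by case: (s =P t) => // ->; case: eqP.
rewrite -[LHS](tens_lift0 _ (fr_comul x)); apply: eq_tens_lift => u v.
by rewrite tens_ffun_pure fr_tens_comul ffunE /=; case: eqP; rewrite ?mulr0.
Qed.

(** * The counit *)

Definition augmentation (h : H) : K^o := scal (\sum_t fr_val h t).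

Fact augmentation_is_linear : linear augmentation.
Proof.
move=> k x y; rewrite /augmentation -scal_is_linear scaler_sumr -big_split.
apply: (congr1 (@scal K L)); apply: eq_bigr => t _.
by rewrite linearP !ffunE.
Qed.

HB.instance Definition _ :=
  GRing.isLinear.Build K H K^o _ augmentation augmentation_is_linear.

Definition fr_counit : 'Hom(H, K^o) := linfun augmentation.

(** Conjugation permutes T, so the sum of the coefficients is Galois-invariant; it lies in K and
    [scal] loses nothing. *)
Lemma fr_counitE h : (fr_counit h : K)%:A = \sum_t fr_val h t.
Proof.
rewrite lfunE; apply: scal1K.
apply: (fixed_in_base galL isoG) => z; rewrite rmorph_sum.
rewrite [RHS](reindex_inj (act_inj conj_action z)).
by apply: eq_bigr => t _; rewrite [RHS]fr_val_eqv.
Qed.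

Lemma fr_counit1 : fr_counit 1 = 1.
Proof.
apply: (can_inj (@scalK K L)); rewrite fr_counitE (bigD1 1%g) //= fr_val1 eqxx.
rewrite big1 ?addr0 ?scale1r // => t /negPf ne_t1.
by rewrite fr_val1 ne_t1.
Qed.

Lemma fr_counitM x y : fr_counit (x * y) = fr_counit x * fr_counit y.
Proof.
apply: (can_inj (@scalK K L)); rewrite -scalerA -[RHS]mulr_algl !fr_counitE.
under eq_bigr do rewrite fr_valM.
rewrite exchange_big mulr_suml; apply: eq_bigr => s _; rewrite mulr_sumr.
rewrite (reindex_inj (mulIg s)); apply: eq_bigr => t _.
by rewrite mulgK.
Qed.

Lemma fr_val_tens_lift (b : H -> H -> H) X t :
  fr_val (tens_lift b X) t = tens_lift (fun u v => fr_val (b u v) t) X.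
Proof. by rewrite linear_tens_lift tens_liftE. Qed.

Lemma fr_counitl x :
  tens_lift (fun u v => fr_counit u *: v) (fr_comul x) = x.
Proof.
apply: fr_val_inj; apply/ffunP=> t; rewrite fr_val_tens_lift.
transitivity
  (\sum_s tens_lift (fun u v => fr_val u s * fr_val v t) (fr_comul x)).
  rewrite -tens_lift_sum; apply: eq_tens_lift => u v.
  by rewrite linearZ ffunE -mulr_suml -fr_counitE mulr_algl.
rewrite (bigD1 t) //= fr_comulE eqxx big1 ?addr0 // => s /negPf ne.
by rewrite fr_comulE ne.
Qed.

Lemma fr_counitr x :
  tens_lift (fun u v => fr_counit v *: u) (fr_comul x) = x.
Proof.
apply: fr_val_inj; apply/ffunP=> t; rewrite fr_val_tens_lift.
transitivity
  (\sum_s tens_lift (fun u v => fr_val u t * fr_val v s) (fr_comul x)).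
  rewrite -tens_lift_sum; apply: eq_tens_lift => u v.
  by rewrite linearZ ffunE -mulr_sumr -fr_counitE mulr_algr.
rewrite (bigD1 t) //= fr_comulE eqxx big1 ?addr0 // => s /negPf ne.
by rewrite fr_comulE eq_sym ne.
Qed.

(** * The antipode *)

Definition flip (h : H) : permring L T := [ffun t => fr_val h t^-1%g].

Lemma flip_fixed h : flip h \in fixed_ring.
Proof.
by apply/mem_fixed_ring => z t; rewrite !ffunE -conj_actionV fr_val_eqv.
Qed.

Definition inversion (h : H) : H := Subvs (flip_fixed h).

Lemma inversionE h t : fr_val (inversion h) t = fr_val h t^-1%g.
Proof. exact: ffunE. Qed.

Fact inversion_is_linear : linear inversion.
Proof.
move=> k x y; apply: fr_val_inj; apply/ffunP=> t.
by rewrite inversionE !linearP !ffunE.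
Qed.

HB.instance Definition _ :=
  GRing.isLinear.Build K H H _ inversion inversion_is_linear.

Definition fr_antipode : 'End(H) := linfun inversion.

Lemma fr_antipodeE h t : fr_val (fr_antipode h) t = fr_val h t^-1%g.
Proof. by rewrite lfunE inversionE. Qed.

Lemma fr_antipodel x :
  tens_lift (fun u v => fr_antipode u * v) (fr_comul x) = fr_counit x *: 1.
Proof.
apply: fr_val_inj; apply/ffunP=> t; rewrite fr_val_tens_lift.
under eq_tens_lift do rewrite fr_valM.
rewrite tens_lift_sum linearZ ffunE fr_val1 -mulr_algl fr_counitE mulr_suml.
rewrite [RHS](reindex_inj invg_inj); apply: eq_bigr => s _ /=.
under eq_tens_lift do rewrite fr_antipodeE.
(* The diagonal condition equates the inverse of [s] with its left multiple by [t], that is,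
   [t = 1]. *)
rewrite fr_comulE -[eqbLHS]mul1g (inj_eq (mulIg _)) eq_sym.
by case: eqP; rewrite ?mulr1 ?mulr0.
Qed.

Lemma fr_antipoder x :
  tens_lift (fun u v => u * fr_antipode v) (fr_comul x) = fr_counit x *: 1.
Proof.
apply: fr_val_inj; apply/ffunP=> t; rewrite fr_val_tens_lift.
under eq_tens_lift do rewrite fr_valM.
rewrite tens_lift_sum linearZ ffunE fr_val1 -mulr_algl fr_counitE mulr_suml.
apply: eq_bigr => s _ /=.
under eq_tens_lift do rewrite fr_antipodeE.
rewrite fr_comulE invMg invgK -[eqbLHS]mulg1 (inj_eq (mulgI _)).
by rewrite eq_sym invg_eq1; case: eqP; rewrite ?mulr1 ?mulr0.
Qed.

Definition fr_hopf : hopf_algebra H :=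
  HopfAlgebra fr_comul1 fr_comulM fr_counit1 fr_counitM fr_comulA
    fr_counitl fr_counitr fr_antipodel fr_antipoder.

(** * The action on L *)

Hypothesis regT : perm_regular T.

(** Regularity leaves only one element of T sending a given point to 0. *)
Lemma preimage0_inj : injective (fun t : subg_of T => (sgval t)^-1%g 0).
Proof.
move=> s t /= eq_st; apply: val_inj.
have [u [_ uniq_u]] := regT ((sgval s)^-1%g 0) 0.
transitivity u.
  by apply/esym/uniq_u; rewrite subgP permKV.
by apply: uniq_u; rewrite subgP eq_st permKV.
Qed.

Lemma card_regular : #|{: subg_of T}| = #|A|.
Proof.
apply/eqP; rewrite eqn_leq (leq_card _ preimage0_inj) /=.
have exT y : [exists t : subg_of T, sgval t 0 == y].
  have [t [[Tt ty] _]] := regT 0 y.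
  by apply/existsP; exists (subg T t); rewrite subgK // ty.
pose g y := xchoose (existsP (exT y)).
have gE y : sgval (g y) 0 = y by apply/eqP/(xchooseP (existsP (exT y))).
by apply: (leq_card g) => x y eq_g; rewrite -[x]gE eq_g gE.
Qed.

(** Grouping the terms by the point that [t] sends to 0 reduces this to [sigma_independent], since
    each group has at most one term. *)
Lemma regular_independent (c : subg_of T -> L) :
  (forall a, \sum_t c t * sigma ((sgval t)^-1%g 0) a = 0) -> forall t, c t = 0.
Proof.
move=> c0 t; pose d z := \sum_(s : subg_of T | (sgval s)^-1%g 0 == z) c s.
have <- : d ((sgval t)^-1%g 0) = c t.
  rewrite /d (bigD1 t) //= big1 ?addr0 // => s /andP[/eqP eq_st ne_st].
  by rewrite (preimage0_inj eq_st) eqxx in ne_st.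
apply: (sigma_independent isoG (c := d)) => a.
rewrite -[RHS](c0 a).
rewrite [RHS](partition_big (fun t : subg_of T => (sgval t)^-1%g 0) xpredT) //=.
by apply: eq_bigr => z _; rewrite mulr_suml; apply: eq_bigr => s /eqP ->.
Qed.

(** The value at 0 of h acting on the image of a in GL; an element of L is the value of its image at
    0. *)
Definition act_val (h : H) (a : L) : L :=
  \sum_t fr_val h t * sigma ((sgval t)^-1%g 0) a.

Fact act_val_is_linear h : linear (act_val h).
Proof.
move=> k a b; rewrite /act_val scaler_sumr -big_split; apply: eq_bigr => t _.
by rewrite linearP mulrDr scalerAr.
Qed.

HB.instance Definition _ h :=
  GRing.isLinear.Build K L L _ (act_val h) (act_val_is_linear h).

Definition act_end (h : H) : 'End(L) := linfun (act_val h).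

Fact act_end_is_linear : linear act_end.
Proof.
move=> k x y; apply/lfunP=> a; rewrite add_lfunE scale_lfunE !lfunE.
rewrite /= /act_val scaler_sumr -big_split; apply: eq_bigr => t _.
by rewrite linearP !ffunE mulrDl scalerAl.
Qed.

HB.instance Definition _ :=
  GRing.isLinear.Build K H 'End(L) _ act_end act_end_is_linear.

Definition fr_act : 'Hom(H, 'End(L)) := linfun act_end.

Lemma fr_actE h a :
  fr_act h a = \sum_t fr_val h t * sigma ((sgval t)^-1%g 0) a.
Proof. by rewrite !lfunE. Qed.

Lemma sigmaD x y a : sigma (x + y) a = sigma y (sigma x a).
Proof. exact: (sigmaM sigma). Qed.

Lemma conj_preimage t (w : A) :
  (sgval (conj_action t w))^-1%g w = (sgval t)^-1%g 0 + w.
Proof.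
have lambda_w0 : lambda_plus w 0 = w by rewrite permE addr0.
by rewrite /= sgvalJ -conjVg -{2}lambda_w0 permJ permE addrC.
Qed.

(** The right-hand side is the value at [w] of h acting on the image of [a] in GL. Equivariance of h
    and [conj_preimage] carry the formula from the point 0 to [w], so the result is again the image
    of an element of L. *)
Lemma sigma_fr_act h a w :
  sigma w (fr_act h a) = \sum_t fr_val h t * sigma ((sgval t)^-1%g w) a.
Proof.
rewrite fr_actE rmorph_sum [RHS](reindex_inj (act_inj conj_action w)).
apply: eq_bigr => t _; rewrite fr_val_eqv [LHS]rmorphM; congr (_ * _).
by rewrite conj_preimage sigmaD.
Qed.

Lemma gal_embedE (a : L) w : gal_embed sigma a w = sigma w a.
Proof.
rewrite sum_ffunE (bigD1 w) //= big1 ?addr0.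
  by rewrite !ffunE eqxx; apply: mulr1.
by move=> y /negPf ne; rewrite !ffunE eq_sym ne scaler0.
Qed.

Lemma pr_actE (f : permring L T) (c : {ffun A -> L^o}) w :
  pr_act f c w = \sum_t f t * c ((sgval t)^-1%g w).
Proof.
rewrite sum_ffunE; apply: eq_bigr => t _; rewrite sum_ffunE.
rewrite (bigD1 ((sgval t)^-1%g w)) //= big1 ?addr0.
  by rewrite !ffunE permKV eqxx; apply: mulr1.
move=> y ne; rewrite !ffunE; case: eqP => [w_def | _]; last exact: mulr0.
by rewrite w_def permK eqxx in ne.
Qed.

Lemma fr_act1 a : fr_act 1 a = a.
Proof.
rewrite fr_actE (bigD1 1%g) //= fr_val1 eqxx mul1r big1 ?addr0.
  by rewrite invg1 perm1; apply: (sigma1 sigma).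
by move=> t /negPf ne; rewrite fr_val1 ne mul0r.
Qed.

Lemma fr_actM (h h' : H) a : fr_act (h * h') a = fr_act h (fr_act h' a).
Proof.
rewrite [RHS]fr_actE; under [RHS]eq_bigr do rewrite sigma_fr_act mulr_sumr.
rewrite fr_actE; under [LHS]eq_bigr do rewrite fr_valM mulr_suml.
rewrite exchange_big; apply: eq_bigr => s _.
rewrite (reindex_inj (mulIg s)); apply: eq_bigr => t _ /=.
by rewrite mulgK mulrA invMg permM.
Qed.

Lemma fr_act_one h : fr_act h 1 = (counit fr_hopf h : K) *: 1.
Proof.
rewrite [RHS]fr_counitE fr_actE; apply: eq_bigr => t _.
by rewrite rmorph1 mulr1.
Qed.

(** Each [sigma z] is multiplicative, which matches a coproduct supported on the diagonal. *)
Lemma fr_act_mul h a b :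
  fr_act h (a * b) =
  tens_lift (fun u v => fr_act u a * fr_act v b) (comul fr_hopf h).
Proof.
pose g (t : subg_of T) := sigma ((sgval t)^-1%g 0).
transitivity (\sum_s \sum_t tens_lift (fun u v => fr_val u s * fr_val v t)
                (fr_comul h) * (g s a * g t b)).
  rewrite fr_actE; apply: eq_bigr => s _.
  rewrite (bigD1 s) //= big1 ?addr0; last first.
    by move=> t /negPf ne; rewrite fr_comulE eq_sym ne mul0r.
  by rewrite fr_comulE eqxx rmorphM.
under eq_bigr do under eq_bigr do rewrite -tens_lift_mulr.
under eq_bigr do rewrite -tens_lift_sum.
rewrite -tens_lift_sum; apply: eq_tens_lift => u v.
rewrite !fr_actE mulr_suml; apply: eq_bigr => s _; rewrite mulr_sumr.
by apply: eq_bigr => t _; rewrite mulrACA.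
Qed.

Lemma dim_galois : \dim {:L} = #|A|.
Proof.
have := galois_dim galL; rewrite dimv1 divn1 => ->.
by rewrite -(card_isog (isom_isog _ _ isoG)) ?cardsT.
Qed.

(** * Bijectivity of the canonical map from L (x) H to End(L) *)

Definition fr_canonical (X : tens L H) : 'End(L) :=
  tens_lift (fun (a : L) (h : H) => (amull a \o fr_act h)%VF : 'End(L)) X.

Lemma fr_canonicalE X a :
  fr_canonical X a =
  \sum_t tens_lift (fun b h => b * fr_val h t) X * sigma ((sgval t)^-1%g 0) a.
Proof.
under eq_bigr do rewrite -tens_lift_mulr.
rewrite -tens_lift_sum.
rewrite /fr_canonical /tens_lift sum_lfunE; apply: eq_bigr => i _.
rewrite sum_lfunE; apply: eq_bigr => j _; rewrite scale_lfunE comp_lfunE lfunE.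
rewrite /= fr_actE mulr_sumr; congr (_ *: _).
by apply: eq_bigr => t _; rewrite mulrA.
Qed.

HB.instance Definition _ := GRing.Linear.copy fr_canonical
  (tens_lift (fun (a : L) (h : H) => (amull a \o fr_act h)%VF : 'End(L))).

(** [regular_independent] kills the L-coefficient of each [t]. Then L-independence of the basis of H
    and K-independence of the basis of L kill the coordinates of the tensor. *)
Lemma fr_canonical_inj : injective fr_canonical.
Proof.
apply: raddf_inj => X X0; apply/matrixP=> i j; rewrite [RHS]mxE.
have X_t t : tens_lift (fun b h => b * fr_val h t) X = 0.
  apply: (regular_independent
    (c := fun t => tens_lift (fun b h => b * fr_val h t) X)) => a.
  by rewrite -fr_canonicalE X0 lfunE.
move: i; have /freeP := basis_free (vbasisP {:L}); apply; move: j.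
apply: (embedding_free galL isoG fr_val_eqv fr_val_inj) => t.
rewrite -[RHS](X_t t) [RHS]exchange_big; apply: eq_bigr => j _.
by rewrite mulr_suml; apply: eq_bigr => i _; rewrite scalerAl.
Qed.

Lemma fr_canonical_bij : bijective fr_canonical.
Proof.
have inj : lker (linfun fr_canonical) == 0%VS.
  by apply/lker0P => X Y; rewrite !lfunE; apply: fr_canonical_inj.
have img : limg (linfun fr_canonical) = fullv.
  apply/eqP; rewrite eqEdim subvf limg_dim_eq ?(eqP inj) ?capv0 //.
  (* Both dimensions are the order of G: that of H through regularity of T, that of L through Galois
     theory. Injectivity therefore implies surjectivity. *)
  have dimH : dim H = dim L.
    by rewrite -!dimvf dim_fixed_ring card_regular dim_galois.
  rewrite !dimvf -[dim 'End(L)]/(dim L * dim L)%N.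
  by rewrite -[X in (_ <= X)%N]/(dim L * dim H)%N dimH leqnn.
exists (linfun fr_canonical)^-1%VF => X.
  by rewrite -[fr_canonical X]lfunE lker0_lfunK.
by rewrite -[fr_canonical _]lfunE limg_lfunVK ?img ?memvf.
Qed.

Definition fr_hopf_galois : hopf_galois L H :=
  HopfGalois fr_act1 fr_actM fr_act_one fr_act_mul fr_canonical_bij.

Lemma fr_yields : yields_hopf_galois sigma fr_hopf_galois.
Proof.
split=> //.
- by move=> f; apply: iff_trans (mem_fixed_ring f) (gal_pr_act_fixed f).
- exact: fr_tens_comul.
- exact: fr_counitE.
- exact: fr_antipodeE.
- move=> h a; apply/ffunP=> w; rewrite gal_embedE pr_actE [LHS]sigma_fr_act.
  by apply: eq_bigr => t _; rewrite gal_embedE.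
Qed.

End FixedRing.

(** * The adjoint group of a nilpotent ring *)

Section AdjointGroup.
Variables (A : finZmodType) (mul : nilpotent_ring A).

Lemma nmul0l a : mul 0 a = 0.
Proof. by apply: (addrI (mul 0 a)); rewrite -nmulDl !addr0. Qed.

Lemma nmul0r a : mul a 0 = 0.
Proof. by apply: (addrI (mul a 0)); rewrite -nmulDr !addr0. Qed.

Lemma nmulNl a b : mul (- a) b = - mul a b.
Proof. by apply: (addrI (mul a b)); rewrite -nmulDl !subrr nmul0l. Qed.

Lemma nmulNr a b : mul a (- b) = - mul a b.
Proof. by apply: (addrI (mul a b)); rewrite -nmulDr !subrr nmul0r. Qed.

Lemma circ0 a : circ mul a 0 = a.
Proof. by rewrite /circ nmul0r !addr0. Qed.

Lemma lambda_circE a x : lambda_circ mul a x = circ mul a x.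
Proof. exact: permE. Qed.

Lemma circ_set_lambda a : lambda_circ mul a \in circ_group mul.
Proof. by apply: imset_f; rewrite inE. Qed.

Definition lambda_subg a : subg_of (circ_group mul) :=
  subg (circ_group mul) (lambda_circ mul a).

Lemma lambda_subgE a : sgval (lambda_subg a) = lambda_circ mul a.
Proof. exact/subgK/circ_set_lambda. Qed.

Lemma lambda_subg_inj : injective lambda_subg.
Proof.
move=> a b eq_ab; rewrite -[a]circ0 -[b]circ0.
have := congr1 (fun t : subg_of (circ_group mul) => sgval t 0) eq_ab.
by rewrite !lambda_subgE !permE.
Qed.

(** The parameter is recovered as the value at 0. The informative form provides the inverse function
    used to reindex sums over T. *)
Lemma lambda_subg_surj t : {a | t = lambda_subg a}.
Proof.
exists (sgval t 0); apply: val_inj; rewrite [RHS]lambda_subgE /=.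
by have /imsetP[a _ ->] := subgP t; rewrite permE circ0.
Qed.

Lemma big_lambda_subg (R : nmodType) (F : subg_of (circ_group mul) -> R) :
  \sum_t F t = \sum_x F (lambda_subg x).
Proof.
apply: reindex; exists (fun t => sval (lambda_subg_surj t)) => [x _ | t _].
  by case: lambda_subg_surj => y /= /lambda_subg_inj.
by case: lambda_subg_surj.
Qed.

Lemma circ_eltE (K : fieldType) (L : fieldExtType K) (b : A -> L) x :
  circ_elt mul b (lambda_subg x) = b x.
Proof.
rewrite /circ_elt sum_ffunE (bigD1 x) //= ffunE eqxx big1 ?addr0 // => y ne.
by rewrite ffunE (inj_eq lambda_subg_inj) eq_sym (negPf ne).
Qed.

Hypothesis mulC : commutative mul.

(** As the adjoint operation is commutative, [b] sends [x] to [y] exactly when [lambda_circ x] sends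
    [b] to [y], which has one solution. *)
Lemma circ_group_regular : perm_regular (circ_group mul).
Proof.
move=> x y; have circC a b : circ mul a b = circ mul b a.
  by rewrite /circ mulC (addrC a).
exists (lambda_circ mul ((lambda_circ mul x)^-1%g y)).
split=> [|t [/imsetP[b _ ->] <-]].
  by rewrite circ_set_lambda lambda_circE circC -lambda_circE permKV.
by rewrite lambda_circE circC -lambda_circE permK.
Qed.

Hypothesis mul3 : forall a b c : A, mul (mul a b) c = 0.

(** With x = z + y, the left side sends x to z + a + y + ay = a + x + ax - az. The right side
    differs from this only by the triple product azx, which is zero. *)
Lemma lambda_circJ a z :
  (lambda_circ mul a ^ lambda_plus z)%g = lambda_circ mul (a - mul a z).
Proof.
apply/permP=> x; rewrite -[x in LHS](permKV (lambda_plus z)) permJ.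
set y := _ x; have -> : x = z + y by rewrite -[x](permKV (lambda_plus z)) permE.
rewrite !permE /circ nmulDl nmulDr nmulNl mul3 oppr0 addr0.
by rewrite [RHS](AC (2*2*2) ((3*(1*4*6))*(5*2))) /= subrr addr0.
Qed.

Lemma circ_group_normalized : normalized_by_lambda_plus (circ_group mul).
Proof.
apply/subsetP=> _ /imsetP[z _ ->]; rewrite inE.
apply/subsetP=> _ /imsetP[t Tt ->].
by have /imsetP[a _ ->] := Tt; rewrite lambda_circJ circ_set_lambda.
Qed.

(** The adjoint product of a with -a + a^2 is the cube of a, which vanishes. This is the source of
    the exponent in the action formula. *)
Lemma lambda_circV0 a : (lambda_circ mul a)^-1%g 0 = - a + mul a a.
Proof.
apply: (@perm_inj _ (lambda_circ mul a)); rewrite permKV lambda_circE /circ.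
by rewrite nmulDr nmulNr (mulC a (mul a a)) mul3 addr0 addrA subrr add0r subrr.
Qed.

End AdjointGroup.

Theorem corollary2p2 (p n : nat) (K : fieldType) (L : splittingFieldType K)
    (A : finZmodType) (mul : nilpotent_ring A)
    (sigma : {morphism [set: A] >-> gal_of {:L}})
    (p_prime : prime p) (p_odd : odd p) (cardA : #|A| = (p ^ n)%N)
    (galL : galois 1%VS {:L})
    (isoG : isom [set: A] 'Gal({:L} / 1%VS) sigma)
    (mulC : commutative mul)
    (mul3 : forall a b c : A, mul (mul a b) c = 0) :
  exists (H : {aspace permring L (circ_group mul)})
         (S : hopf_galois L (subvs_of H)),
    [/\ yields_hopf_galois sigma S,
        forall f, f \in H <->
          exists2 b : A -> L,
            (forall x z, b (x - mul x z) = sigma z (b x)) &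
            f = circ_elt mul b
      & forall (h : subvs_of H) (b : A -> L), vsval h = circ_elt mul b ->
          forall a : L, hg_act S h a =
            \sum_(x : A) b x * sigma (- x + mul x x) a].
Proof.
have regT := circ_group_regular mulC.
have normT := circ_group_normalized mul3.
(* Indexing T by A, conjugation becomes the map from x to x - xz, so equivariance turns into the
   stated condition on [b]. *)
have conjE x z :
    conj_action normT (lambda_subg mul x) z = lambda_subg mul (x - mul x z).
  apply: val_inj; rewrite [LHS](sgvalJ normT) [RHS]lambda_subgE.
  by rewrite lambda_subgE lambda_circJ.
exists (fixed_ring sigma normT), (fr_hopf_galois galL isoG normT regT).
split=> [|f|h b def_h a].
- exact: fr_yields.
- apply: iff_trans (mem_fixed_ring sigma normT f) _.
  split=> [eqv_f | [b eqv_b ->] z t].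
    exists (fun x => f (lambda_subg mul x)) => [x z|].
      by rewrite -eqv_f conjE.
    apply/ffunP=> t; have [x ->] := lambda_subg_surj t.
    by rewrite circ_eltE.
  by have [x ->] := lambda_subg_surj t; rewrite conjE !circ_eltE.
(* The sum over T becomes a sum over A, and the point sent to 0 by [lambda_circ x] is -x + x^2. *)
rewrite [LHS]fr_actE big_lambda_subg; apply: eq_bigr => x _.
rewrite lambda_subgE (lambda_circV0 mulC mul3) -[fr_val _ _ _]/(vsval h) def_h.
by rewrite circ_eltE.
Qed.
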